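(* Let $p>2$ be a prime and $k$ a field of characteristic $p$. Let $I: i_1<i_2<\cdots$ be any increasing sequence of positive integers (finite with at least two terms, or infinite), and let $L_{\infty,I}$ be the $T$-space of $k_0\langle X\rangle$ generated by $\{x_1^px_2^p\cdots x_i^p : i\in I\}$. Then $L_{\infty,I}$ is finitely based; more precisely, it has a $T$-space basis of size at most $i_2-i_1+1$.
   Context: $X=\{x_1,x_2,\ldots\}$ is countably infinite; $k_0\langle X\rangle$ is the free associative (non-unital) $k$-algebra on $X$. A $T$-space is a $k$-subspace of $k_0\langle X\rangle$ invariant under every algebra endomorphism of $k_0\langle X\rangle$ (closed under substituting arbitrary elements for the variables). A $T$-space basis of a $T$-space $V$ is a subset that generates $V$ as a $T$-space. *)

(* Defs.v *)
From HB Require Import structures.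
From mathcomp Require Import all_boot all_order all_algebra.
From mathcomp Require Import finmap monalg.

Set Implicit Arguments.
Unset Strict Implicit.
Unset Printing Implicit Defensive.

Import GRing.Theory.
Local Open Scope ring_scope.

(* The free unital associative k-algebra k<X> on X = {x_0, x_1, x_2, ...}:
   k-linear combinations of words (free monoid {fmonom nat}) with
   concatenation product.  The variable x_i is the word [:: i].
   Only x_1, x_2, ... are used in the statement; X is countably infinite. *)
Definition FA (k : fieldType) := {malg k[{fmonom nat}]}.

Definition xvar (k : fieldType) (i : nat) : FA k := << FMonom [:: i] >>.

(* k_0<X>: the non-unital free algebra = elements of k<X> with zero
   constant term (coefficient of the empty word). *)
Definition in_k0 (k : fieldType) (f : FA k) : Prop := f@_(FMonom [::]) = 0.

Definition subst (k : fieldType) (s : nat -> FA k) (f : FA k) : FA k :=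
  \sum_(m <- msupp f) f@_m *: \prod_(i <- fmonom_val m) s i.

(* A T-space: a k-subspace of k_0<X> closed under every endomorphism of
   k_0<X>, i.e. under every substitution x_i |-> s i with s i in k_0<X>. *)
Definition is_Tspace (k : fieldType) (V : FA k -> Prop) : Prop :=
  [/\ forall f, V f -> in_k0 f,
      V 0,
      forall f g, V f -> V g -> V (f + g),
      forall (c : k) f, V f -> V (c *: f)
    & forall (s : nat -> FA k), (forall i, in_k0 (s i)) ->
        forall f, V f -> V (subst s f)].

Definition Tgen (k : fieldType) (S : FA k -> Prop) (f : FA k) : Prop :=
  forall V, is_Tspace V -> (forall g, S g -> V g) -> V f.

Definition Tbasis (k : fieldType) (B V : FA k -> Prop) : Prop :=
  forall f, Tgen B f <-> V f.

Definition pword (p i : nat) : seq nat :=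
  flatten [seq nseq p j | j <- iota 1 i].

Definition pmon (k : fieldType) (p i : nat) : FA k := << FMonom (pword p i) >>.

Definition L_inf (k : fieldType) (p : nat) (I : nat -> Prop) : FA k -> Prop :=
  Tgen (fun g => exists2 i, I i & g = pmon k p i).

(* Main.v *)
(** Let [L] be the span of the [p]-th powers.  The [T]-space of [x_1^p ... x_m^p] is the
    product [L^m], and [L] is stable under commutators with arbitrary elements.  Put
    [n = i_1], [d = i_2 - i_1] and [W = L^n + L^(n+d) + L^j] with [j >= n + d]; the point is
    that [L^(j+d)] lies in [W].

    For [a] in [L] and [c] in [L^d], the identity [y [a,c] = [a, y c] - [a,y] c] shows that,
    after multiplication by [L^(n-1)], the ideal generated by [[L, L^d]] lies in [W].

    The polarization [P(y,z) = sum_i y^i z y^(p-1-i)] is linear in [z], so that elements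
    of [L] next to it can be moved into [z], up to commutators.  Moving [a], [c] or [a c] into
    [z] yields three elements of [W], and [a c P(y,z)] is an alternating sum of them modulo
    the ideal above.  Hence the products of [j + d - 1] elements of [L] and one polarization
    are in [W].

    Finally, comparing [((x + y)^p)^2] and [((x + y)^2)^p] shows, since [p] is odd, that
    [x^p y^p] is an element of [L] up to products of [P(u,v)] with an element of [L]; doing
    this to [d] disjoint pairs of factors takes [L^(j+d)] into [L^j].
    So the powers of [L] for [i_1], [i_2] and the least element of [I] in each other residue
    class modulo [d] suffice. *)

Require Import Defs.
From HB Require Import structures.
From mathcomp Require Import all_boot all_order all_algebra.
From mathcomp Require Import finmap monalg.
From mathcomp Require Import zify.
From Stdlib Require Import Classical.

Set Implicit Arguments.
Unset Strict Implicit.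
Unset Printing Implicit Defensive.

Import GRing.Theory.
Local Open Scope ring_scope.

(** * Linear subspaces of an algebra and commutator identities *)

Section Subspaces.

Variables (k : fieldType) (A : algType k).
Implicit Types (U W G : A -> Prop) (a b c f g x y z : A).

Definition subspace W :=
  [/\ W 0, forall x y, W x -> W y -> W (x + y)
    & forall (e : k) x, W x -> W (e *: x)].

Definition span G f := forall W, subspace W -> (forall g, G g -> W g) -> W f.

Lemma subspaceN W x : subspace W -> W x -> W (- x).
Proof. by case=> _ _ WZ Wx; rewrite -scaleN1r; apply: WZ. Qed.

Lemma subspaceB W x y : subspace W -> W x -> W y -> W (x - y).
Proof.
by move=> sW Wx Wy; case: (sW) => _ WD _; apply: WD => //; apply: subspaceN.
Qed.

Lemma subspace_sum W (J : Type) (r : seq J) (P : pred J) (F : J -> A) :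
  subspace W -> (forall i, P i -> W (F i)) -> W (\sum_(i <- r | P i) F i).
Proof. by case=> W0 WD _ WF; apply: big_ind. Qed.

Lemma subspace_span G : subspace (span G).
Proof.
split=> [W [] //|x y Gx Gy W sW GW|e x Gx W sW GW].
  by case: (sW) => _ WD _; apply: WD; [apply: Gx | apply: Gy].
by case: (sW) => _ _ WZ; apply: WZ; apply: Gx.
Qed.

Lemma mem_span G g : G g -> span G g.
Proof. by move=> Gg W _; apply. Qed.

Lemma subspace_preim W (phi : A -> A) :
    (forall e x y, phi (e *: x + y) = e *: phi x + phi y) ->
  subspace W -> subspace (fun x => W (phi x)).
Proof.
move=> phiL [W0 WD WZ].
have phi0 : phi 0 = 0.
  by have := phiL (-1) 0 0; rewrite scaler0 addr0 scaleN1r addNr.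
split=> [|x y Wx Wy|e x Wx] /=; first by rewrite phi0.
  by rewrite -[x]scale1r phiL scale1r; apply: WD.
by rewrite -[e *: x]addr0 phiL phi0 addr0; apply: WZ.
Qed.

Lemma subspace_mul W a b : subspace W -> subspace (fun x => W (a * x * b)).
Proof.
apply: subspace_preim => e x y.
by rewrite mulrDr mulrDl -scalerAr -scalerAl.
Qed.

Lemma subspace_mull W a : subspace W -> subspace (fun x => W (a * x)).
Proof. by apply: subspace_preim => e x y; rewrite mulrDr -scalerAr. Qed.

Lemma subspace_mulr W b : subspace W -> subspace (fun x => W (x * b)).
Proof. by apply: subspace_preim => e x y; rewrite mulrDl -scalerAl. Qed.

Lemma subspace_forall (J : Type) (V : J -> A -> Prop) :
  (forall j, subspace (V j)) -> subspace (fun x => forall j, V j x).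
Proof.
move=> sV; split=> [j|x y Vx Vy j|e x Vx j]; case: (sV j) => // V0 VD VZ.
  exact: VD.
exact: VZ.
Qed.

Definition lie a b := a * b - b * a.

Lemma lieC a b : lie a b = - lie b a.
Proof. by rewrite /lie opprB. Qed.

Lemma mulr_lie a b : a * b = b * a + lie a b.
Proof. by rewrite addrC subrK. Qed.

Lemma lieMl a b c : lie (a * b) c = a * lie b c + lie a c * b.
Proof. by rewrite /lie mulrBr mulrBl !mulrA addrA subrK. Qed.

Lemma lieMr a b c : lie a (b * c) = lie a b * c + b * lie a c.
Proof. by rewrite /lie mulrBr mulrBl !mulrA addrA subrK. Qed.

Lemma lie_rot a b c : lie (a * b) c = lie a (b * c) + lie b (c * a).
Proof. by rewrite /lie !mulrA addrA subrK. Qed.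

Lemma lieBl a b c : lie (a - b) c = lie a c - lie b c.
Proof. by rewrite /lie mulrBl mulrBr !opprD !opprK addrACA. Qed.

Lemma lie_jacobi a b c : lie (lie a b) c = lie (lie a c) b + lie a (lie b c).
Proof.
rewrite [lie a b]/lie lieBl !lieMl [_ + lie a c * b]addrC opprD addrACA.
by rewrite -/(lie a (lie b c)).
Qed.

(** Meant for [b] a power of [y] inside [polar p y z]: the three products on the right move [c], [a]
    or both across [b], at the cost of a double commutator. *)
Lemma mul3_lie a b c :
  c * a * b = a * b * c + c * b * a - b * a * c - lie (lie a b) c.
Proof.
rewrite /lie mulrBl mulrBr !mulrA opprB [X in X + (_ - _)]addrAC.
by rewrite [RHS]addrC addrA subrK subrK.
Qed.

Lemma subspace_lie W c : subspace W -> subspace (fun x => W (lie x c)).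
Proof.
apply: subspace_preim => e x y.
by rewrite /lie mulrDl mulrDr -scalerAl -scalerAr scalerBr opprD addrACA.
Qed.

End Subspaces.

(** * Interpolation at the points of the prime field *)

Section Interpolation.

Variables (k : fieldType) (p : nat).
Hypothesis pchark : p \in [pchar k].

Lemma natr_pchar_eq (i j : nat) : (i < p)%N -> (j < p)%N ->
  (i%:R == j%:R :> k) = (i == j).
Proof.
move=> ip jp; wlog le_ij : i j ip jp / (i <= j)%N.
  move=> H; case/orP: (leq_total i j) => ij; first exact: H.
  by rewrite eq_sym H // eq_sym.
rewrite eq_sym -subr_eq0 -natrB // -(dvdn_pcharf pchark).
apply/idP/eqP => [|->]; last by rewrite subnn dvdn0.
have [/eqP d0 _|d_gt0 /(dvdn_leq d_gt0)] := posnP (j - i); lia.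
Qed.

(** The points [0, ..., p - 1] are distinct in [k], so their Vandermonde matrix is invertible; the
    weights are column [r] of its inverse. *)
Lemma interpolation_weights (r : nat) : (r < p)%N ->
  exists mu : 'I_p -> k, forall m, (m < p)%N ->
    \sum_i mu i * i%:R ^+ m = (m == r)%:R.
Proof.
move=> rp; pose a : 'rV[k]_p := \row_j j%:R.
have Vunit : Vandermonde p a \in unitmx.
  rewrite unitmxE det_Vandermonde unitfE.
  apply/prodf_neq0 => i _; apply/prodf_neq0 => j ij.
  by rewrite !mxE subr_eq0 natr_pchar_eq // gtn_eqF.
exists (fun i => invmx (Vandermonde p a) i (Ordinal rp)) => m mp.
have /matrixP/(_ (Ordinal mp) (Ordinal rp)) := mulmxV Vunit.
rewrite !mxE => <-; apply: eq_bigr => i _.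
by rewrite !mxE mulrC.
Qed.

(** Fermat's little theorem; the point [i = 0] forces [m > 0]. *)
Lemma natr_exp_pchar (i m : nat) : (0 < m)%N ->
  i%:R ^+ (m + p.-1) = i%:R ^+ m :> k.
Proof.
have p0 : (0 < p)%N by apply: prime_gt0; apply: pcharf_prime pchark.
case: m => // m _; rewrite addSnnS prednK // exprD exprS mulrC.
congr (_ * _); rewrite -(pFrobenius_autE pchark).
exact: rmorph_nat.
Qed.

Variable A : algType k.

Lemma horner_natE (f : {poly A}) (N i : nat) : (size f <= N)%N ->
  f.[i%:R] = \sum_(m < N) (i%:R ^+ m : k) *: f`_m.
Proof.
move=> /horner_coef_wide ->; apply: eq_bigr => m _.
by rewrite -!natrX scaler_nat mulr_natr.
Qed.

Lemma sum_horner_nat (f : {poly A}) (N : nat) (mu : 'I_p -> k) : (size f <= N)%N ->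
  \sum_i mu i *: f.[i%:R] = \sum_(m < N) (\sum_i mu i * i%:R ^+ m) *: f`_m.
Proof.
move=> szf; under eq_bigr do rewrite (horner_natE _ szf) scaler_sumr.
rewrite exchange_big; apply: eq_bigr => m _.
by rewrite scaler_suml; apply: eq_bigr => i _; rewrite scalerA.
Qed.

(** Since [i^p = i] on the prime field, weights isolating degree 1 also give weight 1 to degree
    [p]. *)
Lemma interpolation_weights1 : (1 < p)%N ->
  exists2 mu : 'I_p -> k,
    forall m, (m < p)%N -> \sum_i mu i * i%:R ^+ m = (m == 1)%N%:R
  & \sum_i mu i * i%:R ^+ p = 1.
Proof.
move=> p1; have [mu mu1] := interpolation_weights p1; exists mu => //.
rewrite -[RHS]/((1 == 1)%N%:R) -mu1 //; apply: eq_bigr => i _.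
by rewrite -[in RHS]natr_exp_pchar // add1n prednK ?expr1 //; lia.
Qed.

End Interpolation.

(** * Polarizations of powers *)

Section Polarization.

Variables (k : fieldType) (A : algType k).
Implicit Types x y z u : A.

(* The generating polynomial of the components of [(x + y)^n] of given degree in [y]. *)
Definition binpoly (x y : A) n : {poly A} := (y%:P * 'X + x%:P) ^+ n.

(** The part of [(y + z)^n] linear in [z], i.e. the derivative of the [n]-th power at [y] in
    direction [z]. *)
Definition polar n (y z : A) := \sum_(j < n) y ^+ j * z * y ^+ (n.-1 - j).

Lemma polarS n y z : polar n.+1 y z = polar n y z * y + y ^+ n * z.
Proof.
rewrite /polar big_ord_recr /= subnn expr0 mulr1; congr (_ + _).
rewrite mulr_suml; apply: eq_bigr => -[j jn] _ /=.
by rewrite -[RHS]mulrA -exprSr; congr (_ * _ ^+ _); lia.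
Qed.

(** Leibniz rule for the derivation [lie _ y]. *)
Lemma lie_exp n (u y : A) : lie (u ^+ n) y = polar n u (lie u y).
Proof.
elim: n => [|n IH]; first by rewrite /lie /polar big_ord0 mul1r mulr1 subrr.
by rewrite exprSr lieMl IH polarS addrC.
Qed.

Lemma comm_poly_nat (f : {poly A}) (i : nat) : comm_poly f i%:R.
Proof. by rewrite /comm_poly; exact/commr_sym/commr_nat. Qed.

Lemma horner_binpoly x y n (i : nat) :
  (binpoly x y n).[i%:R] = (x + i%:R *: y) ^+ n.
Proof.
rewrite /binpoly horner_exp_comm; last exact: comm_poly_nat.
by rewrite hornerD hornerC hornerMX hornerC addrC scaler_nat mulr_natr.
Qed.

Lemma size_binpoly x y n : (size (binpoly x y n) <= n.+1)%N.
Proof.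
apply: leq_trans (size_poly_exp_leq _ _) _; rewrite ltnS -[leqRHS]mul1n leq_mul2r.
apply/orP; right; rewrite size_MXaddC; case: ifP => // _ /=.
exact: size_polyC_leq1.
Qed.

Lemma coef_binpoly0 x y n : (binpoly x y n)`_0 = x ^+ n.
Proof.
rewrite -horner_coef0 -[0](mulr0n 1) horner_binpoly.
by rewrite mulr0n scale0r addr0.
Qed.

Lemma coef_binpoly_top x y n : (binpoly x y n)`_n = y ^+ n.
Proof.
elim: n => [|n IH]; first by rewrite /binpoly !expr0 coefC.
rewrite /binpoly exprSr -/(binpoly x y n) mulrDr mulrA coefD coefMX !coefMC /=.
by rewrite (nth_default 0 (size_binpoly x y n)) mul0r addr0 IH exprSr.
Qed.

Lemma horner_deriv_binpoly x y n (i : nat) :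
  (binpoly x y n)^`().[i%:R] = polar n (x + i%:R *: y) y.
Proof.
elim: n => [|n IH].
  by rewrite /binpoly expr0 derivC horner0 /polar big_ord0.
rewrite /binpoly exprSr -/(binpoly x y n) derivM hornerD.
rewrite !hornerM_comm; try exact: comm_poly_nat.
have -> : (y%:P * 'X + x%:P).[i%:R] = x + i%:R *: y.
  by rewrite -(expr1 (x + _)) -horner_binpoly /binpoly expr1.
rewrite IH horner_binpoly.
by rewrite polarS derivD derivC addr0 derivM derivC mul0r add0r derivX mulr1 hornerC.
Qed.

End Polarization.

(** * Products of [p]-th powers of elements of an ideal [A0] *)

Section PowerSpaces.

Variables (k : fieldType) (A : algType k) (p : nat) (A0 : A -> Prop).
Hypotheses (pchark : p \in [pchar k]) (p_gt2 : (2 < p)%N).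
Hypotheses (sA0 : subspace A0).
Hypotheses (A0Ml : forall x y, A0 y -> A0 (x * y)) (A0Mr : forall x y, A0 x -> A0 (x * y)).
Implicit Types (W : A -> Prop) (a b c f l s t v x y z : A).

Definition powprod m f :=
  exists2 r : seq A, size r = m & (forall u, u \in r -> A0 u) /\ f = \prod_(u <- r) u ^+ p.

Definition Lp m := span (powprod m).

Lemma subspace_Lp m : subspace (Lp m). Proof. exact: subspace_span. Qed.

Lemma Lp_powprod (r : seq A) : (forall u, u \in r -> A0 u) ->
  Lp (size r) (\prod_(u <- r) u ^+ p).
Proof. by move=> rA0; apply: mem_span; exists r. Qed.

Lemma Lp1_exp u : A0 u -> Lp 1 (u ^+ p).
Proof.
move=> uA0; rewrite -[_ ^+ _](big_seq1 *%R u (fun u => u ^+ p)).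
by apply: (@Lp_powprod [:: u]) => v; rewrite inE => /eqP ->.
Qed.

Lemma Lp0_1 : Lp 0 1.
Proof. by have := @Lp_powprod [::]; rewrite big_nil; apply. Qed.

Lemma Lp0_ind W f : subspace W -> W 1 -> Lp 0 f -> W f.
Proof. by move=> sW W1; apply=> // g [r /size0nil -> [_ ->]]; rewrite big_nil. Qed.

Lemma Lp1_ind W f : subspace W -> (forall u, A0 u -> W (u ^+ p)) -> Lp 1 f -> W f.
Proof.
move=> sW Wexp; apply=> // g [[|u [|//]] // _ [rA0 ->]].
by rewrite big_seq1; apply/Wexp/rA0; rewrite mem_head.
Qed.

Lemma LpM m n a b : Lp m a -> Lp n b -> Lp (m + n) (a * b).
Proof.
move=> La /(_ (fun x => Lp (m + n) (a * x))); apply.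
  exact/subspace_mull/subspace_Lp.
move=> _ [r <- [rA0 ->]]; move: La => /(_ (fun x => Lp _ (x * _))); apply.
  exact/subspace_mulr/subspace_Lp.
move=> _ [r' <- [r'A0 ->]]; rewrite -big_cat -size_cat; apply: Lp_powprod => u.
by rewrite mem_cat => /orP[/r'A0|/rA0].
Qed.

Lemma Lp_mul_ind m n W f : subspace W ->
  (forall a b, Lp m a -> Lp n b -> W (a * b)) -> Lp (m + n) f -> W f.
Proof.
move=> sW Wab; apply=> // _ [r szr [rA0 ->]].
rewrite -[r](cat_take_drop m) big_cat; apply: Wab.
  rewrite -[X in Lp X](_ : size (take m r) = m); last by rewrite size_takel // szr leq_addr.
  by apply: Lp_powprod => u /mem_take/rA0.
rewrite -[X in Lp X](_ : size (drop m r) = n); last by rewrite size_drop szr addKn.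
by apply: Lp_powprod => u /mem_drop/rA0.
Qed.

Definition polarspan := span (fun f => exists y z, [/\ A0 y, A0 z & f = polar p y z]).

Lemma subspace_polarspan : subspace polarspan.
Proof. exact: subspace_span. Qed.

Lemma polarspan_polar y z : A0 y -> A0 z -> polarspan (polar p y z).
Proof. by move=> yA0 zA0; apply: mem_span; exists y, z. Qed.

Lemma A0_line x y (i : nat) : A0 x -> A0 y -> A0 (x + i%:R *: y).
Proof. by case: sA0 => _ AD AZ Ax Ay; apply: AD => //; apply: AZ. Qed.

(** Weighting [(y + i z)^p] over the prime field leaves the components of degree 1 and [p] in [z],
    namely [polar p y z + z^p]. *)
Lemma polar_Lp1 y z : A0 y -> A0 z -> Lp 1 (polar p y z).
Proof.
move=> yA0 zA0; have p1 : (1 < p)%N by lia.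
have [mu mu1 mup] := interpolation_weights1 pchark p1.
have pS : (1 < p.+1)%N by lia.
have := sum_horner_nat mu (size_binpoly y z p).
rewrite (bigD1 (Ordinal pS)) //= (bigD1 ord_max) /=; last by apply/eqP => -[]; lia.
rewrite mu1 // mup eqxx !scale1r coef_binpoly_top [X in _ + (_ + X)]big1 ?addr0; last first.
  move=> [m mp] /=; rewrite -!val_eqE /= => /andP[m1 mnp].
  by rewrite mu1 ?(negPf m1) ?scale0r //; lia.
have -> : (binpoly y z p)`_1 = polar p y z.
  rewrite -[1%N]/(0.+1) -[_`__]mulr1n -coef_deriv -horner_coef0.
  by rewrite -[0](mulr0n 1) horner_deriv_binpoly mulr0n scale0r addr0.
move=> eq_sum; rewrite -[polar _ _ _](addrK (z ^+ p)) -eq_sum.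
apply: subspaceB (subspace_Lp 1) _ (Lp1_exp zA0).
apply: subspace_sum (subspace_Lp 1) _ => i _; case: (subspace_Lp 1) => _ _; apply.
by rewrite horner_binpoly; apply: Lp1_exp; apply: A0_line.
Qed.

Lemma polarspan_Lp1 s : polarspan s -> Lp 1 s.
Proof.
by apply=> [|_ [y [z [yA0 zA0 ->]]]]; [exact: subspace_Lp | exact: polar_Lp1].
Qed.

(** By [lie_exp], [[u^p, y]] is the polarization at [u] in direction [[u, y]], which lies in the
    ideal [A0] even when [y] does not. *)
Lemma Lp1_lie a y : Lp 1 a -> Lp 1 (lie a y).
Proof.
apply: (Lp1_ind (W := fun a => Lp 1 (lie a y))) => [|u uA0].
  exact/subspace_lie/subspace_Lp.
rewrite lie_exp; apply: polar_Lp1 => //.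
by apply: (subspaceB sA0); [apply: A0Mr | apply: A0Ml].
Qed.

Lemma Lp_lie m a y : Lp m a -> Lp m (lie a y).
Proof.
elim: m a => [|m IH] a.
  apply: (Lp0_ind (W := fun a => Lp 0 (lie a y))).
    exact/subspace_lie/subspace_Lp.
  by rewrite /lie mul1r mulr1 subrr; case: (subspace_Lp 0).
rewrite -addn1; apply: (Lp_mul_ind (W := fun a => Lp _ (lie a y))) => [|b c Lb Lc].
  exact/subspace_lie/subspace_Lp.
rewrite lieMl; case: (subspace_Lp (m + 1)) => _ LD _; apply: LD; apply: LpM => //.
  exact: Lp1_lie.
exact: IH.
Qed.

(** The derivative of [binpoly x y p] has degree below [p] and takes polarizations as values, so
    interpolation puts its coefficients in [polarspan]. They are those of [binpoly] times an index
    invertible modulo [p]. *)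
Lemma coef_binpoly_polarspan x y i : A0 x -> A0 y -> (0 < i < p)%N ->
  polarspan (binpoly x y p)`_i.
Proof.
case: i => // i xA0 yA0 /= ip.
have [mu mu1] := interpolation_weights pchark (ltnW ip).
have szd : (size (binpoly x y p)^`() <= p)%N.
  by rewrite (leq_trans (size_poly _ _)) // -subn1 leq_subLR add1n size_binpoly.
have := sum_horner_nat mu szd.
rewrite [RHS](bigD1 (Ordinal (ltnW ip))) //= mu1 ?(ltnW ip) // eqxx scale1r.
rewrite [X in _ + X]big1 ?addr0 => [|[m mp] /eqP mi]; last first.
  rewrite mu1 // (_ : (m == i) = false) ?scale0r //.
  by apply/eqP => /= mi'; apply: mi; apply: val_inj.
rewrite coef_deriv => eq_sum.
have i1 : i.+1%:R != 0 :> k by rewrite -(dvdn_pcharf pchark) gtnNdvd.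
rewrite -[_`__]scale1r -(mulVf i1) -scalerA scaler_nat -eq_sum.
case: subspace_polarspan => _ _ SZ.
apply: (SZ); apply: subspace_sum subspace_polarspan _ => j _; apply: (SZ).
by rewrite horner_deriv_binpoly; apply: polarspan_polar => //; apply: A0_line.
Qed.

Definition polarmix := span (fun f => exists s l,
  [/\ polarspan s, Lp 1 l & f = s * l \/ f = l * s]).

(** Only the coefficients of index [0] and [p] are pure [p]-th powers; the others lie in
    [polarspan], or vanish beyond [p]. *)
Lemma polarmix_binpoly x y i j : A0 x -> A0 y -> ~~ (p %| i)%N \/ ~~ (p %| j)%N ->
  polarmix ((binpoly x y p)`_i * (binpoly x y p)`_j).
Proof.
have L1 m : A0 x -> A0 y -> Lp 1 (binpoly x y p)`_m.
  move=> xA0 yA0; have [pm|mp|<-] := ltngtP p m.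
  - rewrite (nth_default 0) ?(leq_trans (size_binpoly _ _ _)) //.
    by case: (subspace_Lp 1).
  - case: m mp => [|m] mp; first by rewrite coef_binpoly0; apply: Lp1_exp.
    by apply: polarspan_Lp1; apply: coef_binpoly_polarspan.
  - by rewrite coef_binpoly_top; apply: Lp1_exp.
have S m : A0 x -> A0 y -> ~~ (p %| m)%N -> polarspan (binpoly x y p)`_m.
  move=> xA0 yA0 npm; have [pm|mp|mp] := ltngtP p m.
  - rewrite (nth_default 0) ?(leq_trans (size_binpoly _ _ _)) //.
    by case: subspace_polarspan.
  - by apply: coef_binpoly_polarspan => //; case: m npm mp => //; rewrite dvdn0.
  - by rewrite -mp dvdnn in npm.
move=> xA0 yA0 [ni|nj]; apply: mem_span.
  by exists (binpoly x y p)`_i, (binpoly x y p)`_j; split; [apply: S|apply: L1|left].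
by exists (binpoly x y p)`_j, (binpoly x y p)`_i; split; [apply: S|apply: L1|right].
Qed.

Lemma polarmix_Lp2 f : polarmix f -> Lp 2 f.
Proof.
apply=> [|_ [s [l [/polarspan_Lp1 Ls Ll [->|->]]]]]; first exact: subspace_Lp.
  exact: (@LpM 1 1).
exact: (@LpM 1 1).
Qed.

(* Both sides of [((x + i y)^p)^2 = ((x + i y)^2)^p] are interpolated over the prime
   field so as to extract the coefficient of [i^1]; on the left this collects the
   components of degree [1], [p] and [2p - 1] in [y]. *)
Lemma exp_mul_exp x y : A0 x -> A0 y ->
  exists2 a, Lp 1 a & polarmix (x ^+ p * y ^+ p - a).
Proof.
move=> xA0 yA0; have p1 : (1 < p)%N by lia.
have [mu mu1 mup] := interpolation_weights1 pchark p1.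
have sL := subspace_Lp 1; have sM : subspace polarmix by apply: subspace_span.
(* [i^(2p) = i^2], and [2 < p] makes the weight of degree 2 zero. *)
have mu2p : \sum_i mu i * i%:R ^+ (p + p) = 0.
  rewrite -[RHS]/((2 == 1)%N%:R) -mu1 //; apply: eq_bigr => i _.
  rewrite -[in RHS](natr_exp_pchar pchark) // -[in RHS](natr_exp_pchar pchark) //.
  by congr (_ * _ ^+ _); lia.
pose q := binpoly x y p.
have szq2 : (size (q * q)%R <= (p + p).+1)%N.
  have -> : q * q = binpoly x y (p + p) by rewrite /binpoly exprD.
  exact: size_binpoly.
pose X := x ^+ p * y ^+ p.
have LX : exists2 f, Lp 1 f & polarmix (X *+ 2 - f).
  (* The commutator turns the term [y^p x^p] of the degree [p] coefficient into a second
     [x^p y^p]. *)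
  exists (\sum_i mu i *: (q * q).[i%:R] + lie (x ^+ p) (y ^+ p)).
    case: sL => _ LD LZ; apply: LD; last by apply: Lp1_lie; apply: Lp1_exp.
    apply: subspace_sum (subspace_Lp 1) _ => i _; apply: LZ.
    rewrite hornerM_comm; last exact: comm_poly_nat.
    rewrite horner_binpoly -exprMn_comm //.
    by apply: Lp1_exp; apply: A0Mr; apply: A0_line.
  have pS : (p < (p + p).+1)%N by lia.
  rewrite (sum_horner_nat mu szq2) (bigD1 (Ordinal pS)) //= mup scale1r.
  set R := \sum_(i < _ | _) _.
  have MR : polarmix R.
    apply: subspace_sum (sM) _ => -[m mp] /eqP mnp /=.
    have [m0|m0] := eqVneq m 0%N.
      by rewrite m0 mu1 ?scale0r //; [case: sM | lia].
    have [m2|m2] := eqVneq m (p + p)%N; first by rewrite m2 mu2p scale0r; case: sM.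
    case: (sM) => _ _; apply; rewrite coefM; apply: subspace_sum (sM) _ => j _.
    apply: polarmix_binpoly => //; apply/orP; rewrite -negb_and; apply/negP => /andP[pj pmj].
    (* Two indices divisible by [p] force [m] to be [0], [p] or [2p], cases already set aside. *)
    have : (p %| m)%N by rewrite -(subnKC (ltn_ord j : (j <= m)%N)) dvdn_add.
    case/dvdnP => c mc; apply: mnp; apply: val_inj => /=.
    case: c mc => [|[|[|c]]]; nia.
  rewrite coefM (bigD1 ord0) //= (bigD1 ord_max) /=; last by apply/eqP => -[]; lia.
  rewrite subn0 subnn coef_binpoly0 coef_binpoly_top.
  set M := \sum_(i < _ | _) _.
  have MM : polarmix M.
    apply: subspace_sum (sM) _ => -[m mp] /= /andP[/eqP m0 /eqP mnp].
    apply: polarmix_binpoly => //; left; apply/negP => /dvdn_leq.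
    case: m mp m0 mnp => [|m] mp m0 mnp; first by case: m0; apply: val_inj.
    by move=> /(_ isT) pm; apply: mnp; apply: val_inj => /=; lia.
  have -> : X *+ 2 - (X + (y ^+ p * x ^+ p + M) + R + lie (x ^+ p) (y ^+ p)) = - (M + R).
    rewrite /lie -/X mulr2n; set Y := y ^+ p * x ^+ p.
    by rewrite -[X + _ + R]addrA addrACA -(addrA Y) [Y + _]addrC addrK opprD addrA subrr add0r.
  by apply: subspaceN (sM) _; case: (sM) => _ MD _; apply: MD.
have [f Lf Mf] := LX.
have two : 2%:R != 0 :> k by rewrite -(dvdn_pcharf pchark) gtnNdvd.
exists (2%:R^-1 *: f); first by case: sL => _ _; apply.
rewrite -/X (_ : X - _ = 2%:R^-1 *: (X *+ 2 - f)); last first.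
  by rewrite scalerBr -scaler_nat scalerA mulVf // scale1r.
by case: sM => _ _; apply.
Qed.

(** * Reduction of [L^(j+d)] to three lower powers *)

Section Reduction.

Variables (W : A -> Prop) (n d : nat).
Hypotheses (sW : subspace W) (d_gt0 : (0 < d)%N).
Hypotheses (W_n : forall f, Lp n.+1 f -> W f) (W_nd : forall f, Lp (n.+1 + d) f -> W f).

(** The two-sided ideal generated by [f] enters [W] after left multiplication by [n] factors. Here
    [n] is [i_1 - 1]. *)
Definition negligible f := forall t y z, Lp n t -> W (t * y * f * z).

Lemma subspace_negligible : subspace negligible.
Proof.
apply: subspace_forall => t; apply: subspace_forall => y; apply: subspace_forall => z.
have [sW0 sWD sWZ] := subspace_mul (t * y) z sW.
split=> [_|f g Wf Wg Lt|e f Wf Lt] //; last by apply: sWZ; apply: Wf.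
by apply: sWD; [apply: Wf | apply: Wg].
Qed.

Lemma negligibleMl x f : negligible f -> negligible (x * f).
Proof. by move=> Nf t y z Lt; rewrite !mulrA -(mulrA t); apply: Nf. Qed.

Lemma negligibleMr x f : negligible f -> negligible (f * x).
Proof. by move=> Nf t y z Lt; rewrite -!mulrA !(mulrA t) mulrA; apply: Nf. Qed.

Lemma negligibleN f : negligible f -> negligible (- f).
Proof. exact: subspaceN subspace_negligible. Qed.

Lemma negligibleD f g : negligible f -> negligible g -> negligible (f + g).
Proof. by case: subspace_negligible => _ ND _; apply: ND. Qed.

(** In [t y [a,c] = t [a, y c] - t [a,y] c] the terms have [n + 1] and [n + 1 + d] factors. A right
    factor [z] is moved left across [[a,c]]; the Jacobi identity writes [[[a,c],z]] as commutators
    of the same type. *)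
Lemma negligible_lie1 a c : Lp 1 a -> Lp d c -> negligible (lie a c).
Proof.
have W1 t y b e : Lp n t -> Lp 1 b -> Lp d e -> W (t * y * lie b e).
  move=> Lt Lb Le.
  have -> : t * y * lie b e = t * lie b (y * e) - t * lie b y * e.
    by rewrite lieMr [t * (_ + _)]mulrDr !mulrA [X in X - _]addrC addrK.
  apply: (subspaceB sW).
    by apply: W_n; rewrite -addn1; apply: LpM => //; apply: Lp_lie.
  apply: W_nd; apply: LpM => //.
  by rewrite -addn1; apply: LpM => //; apply: Lp_lie.
move=> La Lc t y z Lt.
have -> : t * y * lie a c * z = t * (y * z) * lie a c + t * y * lie (lie a c) z.
  by rewrite -(mulrA (t * y)) [lie a c * z]mulr_lie [t * y * (_ + _)]mulrDr !mulrA.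
rewrite lie_jacobi [t * y * (_ (lie a z) c + _)]mulrDr; case: (sW) => _ WD _.
apply: (WD); first exact: W1.
by apply: (WD); apply: W1 => //; [apply: Lp_lie | apply: Lp_lie].
Qed.

Lemma negligible_lie q a c : Lp q a -> Lp d c -> negligible (lie a c).
Proof.
move=> La Lc; elim: q a La => [|q IH] a.
  apply: (Lp0_ind (W := fun a => negligible (lie a c))).
    exact/subspace_lie/subspace_negligible.
  by rewrite /lie mul1r mulr1 subrr; case: subspace_negligible.
apply: (Lp_mul_ind (m := 1) (W := fun a => negligible (lie a c))) => [|x y Lx Ly].
  exact/subspace_lie/subspace_negligible.
rewrite lieMl; apply: negligibleD; first exact/negligibleMl/IH.
exact/negligibleMr/negligible_lie1.
Qed.

(** The cyclic identity [[a b, y] = [a, b y] + [b, y a]] peels off one factor [a], leaving [b y] in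
    [L^d]; the second term keeps [d + 1] factors in all, with one fewer on the left. *)
Lemma negligible_rot m u x y : (m + u = d.+1)%N -> Lp m x -> Lp u y ->
  negligible (lie x y).
Proof.
elim: m u x y => [|m IH] u x y mu.
  move=> Lx Ly; move: Lx.
  apply: (Lp0_ind (W := fun x => negligible (lie x y))).
    exact/subspace_lie/subspace_negligible.
  by rewrite /lie mul1r mulr1 subrr; case: subspace_negligible.
move=> Lx Ly; move: Lx.
apply: (Lp_mul_ind (m := 1) (W := fun x => negligible (lie x y))) => [|a b La Lb].
  exact/subspace_lie/subspace_negligible.
rewrite lie_rot; apply: negligibleD.
  apply: negligible_lie1 => //; rewrite (_ : d = (m + u)%N); first exact: LpM.
  lia.
by apply: (IH (u + 1)%N) => //; [lia | apply: LpM].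
Qed.

Variable j : nat.
Hypotheses (le_ndj : (n.+1 + d <= j)%N) (W_j : forall f, Lp j f -> W f).

(* Moving an element of [L] into the second argument of [polar p] lowers the number
   of factors.  Modulo negligible elements, moving [a], [c] and [a c] gives three
   elements of [W] whose alternating sum is the given product. *)
Lemma mem_Lp_polar t a c y z : Lp n t -> Lp d a -> Lp (j - n.+1) c -> A0 y -> A0 z ->
  W (t * c * a * polar p y z).
Proof.
move=> Lt La Lc yA0 zA0; case: (sW) => W0 WD WZ.
have W1 : W (t * a * polar p y (c * z)).
  apply: W_nd; rewrite addSn -addn1; apply: LpM; first exact: LpM.
  by apply: polar_Lp1 => //; apply: A0Ml.
have W2 : W (t * c * polar p y (a * z)).
  apply: W_j; rewrite (_ : j = n + (j - n.+1) + 1)%N; last lia.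
  by apply: LpM; [exact: LpM | apply: polar_Lp1 => //; apply: A0Ml].
have W3 : W (t * polar p y (a * c * z)).
  apply: W_n; rewrite -addn1; apply: LpM => //.
  by apply: polar_Lp1 => //; apply: A0Ml.
(* The double commutators of [mul3_lie]; they are negligible because [[a, y^i]] stays in [L^d]. *)
pose R := \sum_(i < p) t * 1 * lie (lie a (y ^+ i)) c * (z * y ^+ (p.-1 - i)).
have WR : W R.
  apply: subspace_sum (sW) _ => i _; rewrite lieC.
  apply: negligibleN => //; apply: negligible_lie Lc _.
  exact: Lp_lie.
have -> : t * c * a * polar p y z = t * a * polar p y (c * z) +
    t * c * polar p y (a * z) - t * polar p y (a * c * z) - R.
  rewrite /polar /R !mulr_sumr -big_split /= -!sumrB; apply: eq_bigr => i _.
  rewrite -!mulrA (mulrA c) (mulrA (c * a)) (mul3_lie a); move: (lie _ c) => L.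
  by rewrite mul1r !mulrBl mulrDl !mulrBr mulrDr !mulrA.
by apply: subspaceB (sW) _ WR; apply: subspaceB (sW) _ W3; apply: WD.
Qed.

Lemma mem_Lp_polarspan l s : Lp (j + d - 1) l -> polarspan s -> W (l * s).
Proof.
move=> Ll Ss; move: Ll; rewrite (_ : j + d - 1 = n + (j - n.+1) + d)%N; last lia.
apply: (Lp_mul_ind (W := fun l => W (l * s))) => [|b a Lb La].
  exact: subspace_mulr.
move: Lb; apply: (Lp_mul_ind (W := fun b => W (b * a * s))) => [|t c Lt Lc].
  apply: (@subspace_preim _ _ W (fun b => b * a * s)) => // e f1 f2.
  by rewrite !mulrDl -!scalerAl.
apply: (Ss (fun s => W (t * c * a * s))); first exact: subspace_mull.
by move=> _ [y [z [yA0 zA0 ->]]]; apply: mem_Lp_polar.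
Qed.

(** Blocks of [d] factors to the right of [s] are moved to its left modulo negligible terms. When
    [u < d] remain, [d - u] factors [x] are borrowed from [l]: [x s] and [v] then have [d + 1]
    factors together, so [negligible_rot] lets them commute and [s] ends up last. *)
Lemma mem_Lp_polarspan_Lp r u l s v : (n <= r)%N -> (r + u = j + d - 1)%N ->
  Lp r l -> polarspan s -> Lp u v -> W (l * s * v).
Proof.
have [m] := ubnP u; elim: m => // m IH in r u l v *; rewrite ltnS => um nr ru Ll Ss Lv.
have Ls := polarspan_Lp1 Ss; case: (sW) => _ WD _.
have [ud|du] := leqP d u.
  move: Lv; rewrite -(subnKC ud).
  apply: (Lp_mul_ind (W := fun v => W (l * s * v))) => [|v1 v2 Lv1 Lv2].
    exact: subspace_mull.
  have -> : l * s * (v1 * v2) = l * v1 * s * v2 + l * lie s v1 * v2.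
    rewrite -(mulrA l v1) mulrA -(mulrA l s) [s * v1]mulr_lie [l * (_ + _)]mulrDr.
    by rewrite [X in X = _]mulrDl !mulrA.
  apply: WD; first by apply: (IH (r + d)%N (u - d)%N) => //; [lia|lia|lia|apply: LpM].
  move: Ll; rewrite -(subnKC nr).
  apply: (Lp_mul_ind (W := fun l => W (l * lie s v1 * v2))) => [|t l' Lt _].
    apply: (@subspace_preim _ _ W (fun l => l * _ * v2)) => // e f1 f2.
    by rewrite !mulrDl -!scalerAl.
  exact: negligible_lie1.
move: Ll; rewrite (_ : r = n + (r - n - (d - u)) + (d - u))%N; last lia.
apply: (Lp_mul_ind (W := fun l => W (l * s * v))) => [|l' x Ll' Lx].
  apply: (@subspace_preim _ _ W (fun l => l * s * v)) => // e f1 f2.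
  by rewrite !mulrDl -!scalerAl.
have -> : l' * x * s * v = l' * v * x * s + l' * lie (x * s) v.
  by rewrite -!(mulrA l') [x * s * v]mulr_lie [l' * (_ + _)]mulrDr !mulrA.
apply: WD.
  apply: mem_Lp_polarspan => //.
  rewrite (_ : j + d - 1 = n + (r - n - (d - u)) + u + (d - u))%N; last lia.
  by apply: LpM => //; apply: LpM.
move: Ll'.
apply: (Lp_mul_ind (W := fun l => W (l * lie (x * s) v))) => [|t l'' Lt _].
  exact: subspace_mulr.
rewrite -[X in W X]mulr1; apply: (negligible_rot _ (LpM Lx Ls) Lv) => //; lia.
Qed.

Lemma Lp_step f : Lp (j + d) f -> W f.
Proof.
(* [i] counts the pairs still to be merged. Each merged pair is replaced by an element lying in both
   [L] and [L^2], so [b] has two factor counts: the short one reaches [L^j] at [i = 0], the long one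
   keeps [j + d] factors in the error terms. *)
suff mem i : (i <= d)%N -> forall l b, Lp (j - d + (i + i)) l ->
    Lp (d - i) b -> Lp (d - i + (d - i)) b -> W (l * b).
  move=> Lf; rewrite -[f]mulr1; apply: (mem d); rewrite ?subnn //; try exact: Lp0_1.
  by rewrite addnA subnK //; lia.
elim: i => [|i IH] id l b.
  rewrite !addn0 subn0 => Ll Lb _; apply: W_j.
  by rewrite (_ : j = j - d + d)%N; [apply: LpM | lia].
move=> Ll Lb Lb2; case: (sW) => _ WD _.
move: Ll; rewrite (_ : j - d + (i.+1 + i.+1) = j - d + (i + i) + 2)%N; last lia.
apply: (Lp_mul_ind (W := fun l => W (l * b))) => [|l' g Ll' Lg]; first exact: subspace_mulr.
move: Lg; apply: (Lp_mul_ind (m := 1) (n := 1) (W := fun g => W (l' * g * b))) => [|g' h Lg' Lh].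
  exact: subspace_mul.
move: Lg'; apply: (Lp1_ind (W := fun g => W (l' * (g * h) * b))) => [|x xA0].
  apply: (@subspace_preim _ _ W (fun g => l' * (g * h) * b)) => // e f1 f2.
  by rewrite !mulrDl mulrDr mulrDl -!scalerAl -scalerAr -!scalerAl.
move: Lh; apply: (Lp1_ind (W := fun h => W (l' * (x ^+ p * h) * b))) => [|y yA0].
  apply: (@subspace_preim _ _ W (fun h => l' * (x ^+ p * h) * b)) => // e f1 f2.
  by rewrite mulrDr mulrDr mulrDl -!scalerAr -scalerAl.
have [a La Ma] := exp_mul_exp xA0 yA0.
have La2 : Lp 2 a.
  rewrite -[a](subKr (x ^+ p * y ^+ p)); apply: subspaceB (subspace_Lp 2) _ _.
    by apply: (@LpM 1 1); apply: Lp1_exp.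
  exact: polarmix_Lp2.
rewrite -[x ^+ p * _](subrK a) mulrDr mulrDl; apply: WD; last first.
  rewrite -mulrA; apply: IH => //; first exact: ltnW.
    by rewrite (_ : d - i = 1 + (d - i.+1))%N; [apply: LpM | lia].
  rewrite (_ : d - i + (d - i) = 2 + (d - i.+1 + (d - i.+1)))%N; last lia.
  exact: LpM.
(* In each error term, [j + d - 1] factors accompany the element [s] of [polarspan]. *)
apply: (Ma (fun g => W (l' * g * b))); first exact: subspace_mul.
move=> _ [s [m [Ss Lm [->|->]]]].
  rewrite mulrA -mulrA; apply: (mem_Lp_polarspan_Lp _ _ Ll' Ss (LpM Lm Lb2)); lia.
rewrite mulrA; apply: (mem_Lp_polarspan_Lp _ _ (LpM Ll' Lm) Ss Lb2); lia.
Qed.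

End Reduction.

End PowerSpaces.

(** * The free algebra and its T-spaces *)

Section FreeAlgebra.

Variable k : fieldType.
Implicit Types f g : FA k.

Lemma FA_scalerAr (e : k) f g : e *: (f * g) = f * (e *: g).
Proof.
have eC : e%:MP * f = f * e%:MP.
  rewrite !malgM_def fgmulUg fgmulgU; apply: eq_bigr => m _.
  by rewrite mulrC mul1m mulm1.
by rewrite -!mul_malgC !mulrA eC.
Qed.

HB.instance Definition _ := GRing.Lalgebra.on (FA k).
HB.instance Definition _ := GRing.Lalgebra_isAlgebra.Build k (FA k) FA_scalerAr.

Lemma in_k0M f g : in_k0 f \/ in_k0 g -> in_k0 (f * g).
Proof.
have one : FMonom [::] = mone :> {fmonom nat} by rewrite -fmoneE.
by rewrite /in_k0 one rmorphM /= => -[] ->; rewrite ?mul0r ?mulr0.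
Qed.

Lemma subspace_in_k0 : subspace (@in_k0 k : FA k -> Prop).
Proof.
split=> [|f g f0 g0|e f f0]; rewrite /in_k0.
- exact: mcoeff0.
- by rewrite mcoeffD f0 g0 addr0.
- by rewrite mcoeffZ f0 mulr0.
Qed.

Lemma prod_pword p i (s : nat -> FA k) :
  \prod_(j <- pword p i) s j = \prod_(j <- iota 1 i) s j ^+ p.
Proof.
rewrite /pword; elim: (iota 1 i) => [|j r IH] /=; first by rewrite !big_nil.
rewrite big_cat IH big_cons; congr (_ * _).
by elim: p {IH} => [|p IH] /=; rewrite ?big_nil // big_cons IH exprS.
Qed.

Lemma subst_pmon p i (s : nat -> FA k) :
  subst s (pmon k p i) = \prod_(j <- iota 1 i) s j ^+ p.
Proof. by rewrite /subst /pmon msuppU1 big_seq_fset1 mcoeffUU scale1r prod_pword. Qed.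

Lemma malg_word (w : seq nat) : << FMonom w >> = \prod_(j <- w) xvar k j.
Proof.
elim: w => [|j w IH]; first by rewrite big_nil -fmoneE.
rewrite big_cons -IH /xvar malgM_def fgmulUU mulr1.
by rewrite -[mmul _ _]/(fmmul _ _) fmmulE.
Qed.

(** Any product of [i] [p]-th powers from [k_0<X>] is a substitution instance of [pmon k p i]. *)
Lemma Lp_Tspace p i (V : FA k -> Prop) f :
  is_Tspace V -> V (pmon k p i) -> Lp p (@in_k0 k) i f -> V f.
Proof.
case=> _ V0 VD VZ Vsubst Vi; apply=> [|_ [r szr [r0 ->]]]; first by split.
rewrite -szr in Vi.
(* The shift accounts for variables starting at [x_1]; the default [0] has no constant term, so the
   substitution is admissible. *)
pose s j : FA k := nth 0 r j.-1.
have -> : \prod_(u <- r) u ^+ p = subst s (pmon k p (size r)).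
  rewrite subst_pmon (iotaDl 1 0) big_map (big_nth 0).
  by rewrite /index_iota subn0.
apply: Vsubst => // j; rewrite /s; have [jr|jr] := ltnP j.-1 (size r).
  exact/r0/mem_nth.
by rewrite nth_default // /in_k0 mcoeff0.
Qed.

Lemma Lp_pmon p i : Lp p (@in_k0 k) i (pmon k p i).
Proof.
rewrite /pmon malg_word prod_pword.
have := @Lp_powprod _ _ p (@in_k0 k) [seq xvar k j | j <- iota 1 i].
rewrite big_map size_map size_iota; apply=> _ /mapP[j _ ->].
by rewrite /in_k0 mcoeffU1 fmP.
Qed.

End FreeAlgebra.

(** * Least elements of residue classes and the finite basis *)

Lemma ex_least (P : nat -> Prop) :
  (exists m, P m) -> exists2 m, P m & forall j, P j -> (m <= j)%N.
Proof.
case=> m; elim/ltn_ind: m => m IH Pm.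
have [[j [jm Pj]]|no] := classic (exists j, (j < m)%N /\ P j); first exact: IH Pj.
exists m => // j Pj; rewrite leqNgt; apply/negP => jm.
by apply: no; exists j.
Qed.

(** Each residue in [rs] contributes the least element of [I] in its class, or nothing if the class
    misses [I]. *)
Lemma residue_representatives (I : nat -> Prop) d (rs : seq nat) :
  exists ms : seq nat, [/\ (size ms <= size rs)%N,
    forall m, m \in ms -> I m /\ (m %% d)%N \in rs
  & forall j, I j -> (j %% d)%N \in rs ->
      exists m, [/\ m \in ms, (m <= j)%N & j = m %[mod d]]].
Proof.
elim: rs => [|r rs [ms [szms msI msP]]]; first by exists [::].
have [/ex_least[m [Im mr] mP]|no] := classic (exists j, I j /\ (j %% d)%N = r).
  exists (m :: ms); split=> // [m'|j Ij].
    rewrite !inE => /orP[/eqP ->|/msI[Im' rm']]; first by rewrite mr eqxx.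
    by rewrite rm' orbT.
  rewrite inE => /orP[/eqP jr|/(msP j Ij)[m' [m'ms m'j eqm']]].
    by exists m; rewrite mem_head mP // mr jr.
  by exists m'; rewrite inE m'ms orbT.
exists ms; split=> [|m /msI[Im rm]|j Ij]; first exact: leqW.
  by rewrite inE rm orbT.
rewrite inE => /orP[/eqP jr|]; last exact: msP.
by case: no; exists j.
Qed.

Theorem theorem4p1 (p : nat) (k : fieldType) (I : nat -> Prop) (i1 i2 : nat) :
  prime p -> (2 < p)%N -> p \in [pchar k]%R ->
  (forall i, I i -> (0 < i)%N) ->
  I i1 -> I i2 -> (i1 < i2)%N ->
  (forall i, I i -> (i < i2)%N -> i = i1) ->
  exists B : seq (FA k),
    (size B <= i2 - i1 + 1)%N /\ Tbasis (fun g => g \in B) (@L_inf k p I).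
Proof.
move=> p_prime p_gt2 pchark I_gt0 Ii1 Ii2 lt_i12 I_lt.
pose d := (i2 - i1)%N; have d_gt0 : (0 < d)%N by rewrite subn_gt0.
(* As [i1] and [i2] share a class modulo [d], there remain [d - 1] residues, hence at most [d + 1]
   generators. *)
pose rs := rem (i1 %% d)%N (iota 0 d).
have [ms [szms msI msP]] := residue_representatives I d rs.
have mod_iota j : (j %% d)%N \in iota 0 d by rewrite mem_iota ltn_mod.
have in_rs j : ((j %% d)%N \in rs) = (j %% d != i1 %% d)%N.
  by rewrite mem_rem_uniq ?iota_uniq // !inE mod_iota andbT.
have szrs : size rs = d.-1 by rewrite size_rem ?size_iota.
have i1_gt0 := I_gt0 _ Ii1.
exists [seq pmon k p i | i <- i1 :: i2 :: ms]; split.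
  by rewrite size_map /=; move: szms d_gt0; rewrite szrs /d; lia.
move=> f; split=> Lf V VT VI.
  apply: Lf => // _ /mapP[i ims ->]; apply: VI; exists i => //.
  by move: ims; rewrite !inE => /or3P[/eqP ->|/eqP ->|/msI[]].
apply: Lf => // _ [j Ij ->]; move: j Ij.
have VB i : i \in i1 :: i2 :: ms -> forall f, Lp p (@in_k0 k) i f -> V f.
  by move=> ims g; apply: Lp_Tspace => //; apply/VI/map_f.
have sV : @subspace k (FA k) V by case: VT.
have step i j : (i2 <= i)%N -> (i <= j)%N -> j = i %[mod d] ->
    (forall f, Lp p (@in_k0 k) i f -> V f) -> forall f, Lp p (@in_k0 k) j f -> V f.
  move=> i2i ij /eqP; rewrite eqn_mod_dvd // => /dvdnP[q jiq] Vi.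
  rewrite -(subnKC ij) jiq; elim: q {jiq} => [|q IH]; first by rewrite addn0.
  rewrite mulSn [(d + _)%N]addnC addnA.
  apply: (@Lp_step _ _ p (@in_k0 k) pchark p_gt2 (subspace_in_k0 k) _ _ V i1.-1) => //.
  - by move=> f1 g g0; apply: in_k0M; right.
  - by move=> f1 g f0; apply: in_k0M; left.
  - by rewrite prednK //; apply: VB; rewrite mem_head.
  - rewrite prednK // subnKC; last exact: ltnW.
    by apply: VB; rewrite !inE eqxx orbT.
  - by rewrite prednK // subnKC ?(ltnW lt_i12) // (leq_trans i2i) // leq_addr.
move=> j Ij; suff: forall g, Lp p (@in_k0 k) j g -> V g by apply; apply: Lp_pmon.
have [ji2|i2j] := ltnP j i2; first by rewrite (I_lt _ Ij ji2); apply: VB; rewrite mem_head.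
have [eqj|neqj] := eqVneq (j %% d)%N (i1 %% d)%N.
  apply: (step i2) => //; last by apply: VB; rewrite !inE eqxx orbT.
  by rewrite eqj -(subnK (ltnW lt_i12)) modnDl.
have [m [mms mj eqm]] := msP j Ij (etrans (in_rs j) neqj).
have [Im rm] := msI m mms.
apply: (step m) => //; last by apply: VB; rewrite !inE mms !orbT.
(* A representative below [i2] would be [i1], whose class was removed; so [m] meets the lower bound
   of [step]. *)
rewrite leqNgt; apply/negP => /(I_lt _ Im) m1.
by rewrite m1 in_rs eqxx in rm.
Qed.
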